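(* Let $S$ be a finite left-regular band (LRB) with identity and let $w=\sum_{x\in S}w_x x\in\mathbb{R}S$ be a probability distribution on $S$ (i.e. $w_x\ge 0$ and $\sum_x w_x=1$). Then the subalgebra $\mathbb{R}[w]\subseteq\mathbb{R}S$ (with identity) generated by $w$ is split semisimple. Consequently, the action of $w$ on any $\mathbb{R}S$-module is diagonalizable.
   Context: A finite semigroup $S$ with identity is a left-regular band (LRB) if there are a lattice $L$ and a surjection $\operatorname{supp}\colon S\to L$ such that $\operatorname{supp}(xy)=\operatorname{supp}x\vee\operatorname{supp}y$ for all $x,y\in S$, and $xy=x$ whenever $\operatorname{supp}y\le\operatorname{supp}x$. (Equivalently: $x^2=x$ and $xyx=xy$ for all $x,y\in S$.) $\mathbb{R}S$ is the semigroup algebra of $S$ over $\mathbb{R}$. A finite-dimensional commutative $k$-algebra over a field $k$ is split semisimple if it is isomorphic as a $k$-algebra to a finite direct product of copies of $k$. The action of $w$ on a module $V$ is diagonalizable if $V$ is the direct sum of eigenspaces of $w$ with real eigenvalues. *)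

(* Defs.v *)
From HB Require Import structures.
From mathcomp Require Import all_boot all_order all_algebra all_field.
From mathcomp Require Import finmap.

Set Implicit Arguments.
Unset Strict Implicit.
Unset Printing Implicit Defensive.

Import Order.TTheory GRing.Theory Num.Theory.
Local Open Scope ring_scope.

#[short(type="finMonoidType")]
HB.structure Definition FinMonoid := {S of Finite S & Monoid S}.

(* [L] need not be assumed finite: it is the image of the finite type [S]. *)
Definition left_regular_band (S : finMonoidType) : Prop :=
  exists (d : Order.disp_t) (L : latticeType d) (supp : S -> L),
    [/\ forall a : L, exists x : S, supp x = a,
        forall x y : S, supp (x * y)%g = (supp x `|` supp y)%O
      & forall x y : S, (supp y <= supp x)%O -> (x * y)%g = x].

(* An element of the semigroup algebra is its coefficient function; the alias
   keeps the convolution product apart from the pointwise ring structure that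
   [{ffun S -> K}] already carries. *)
Definition monoid_algebra (K : fieldType) (S : finMonoidType) : predArgType :=
  {ffun S -> K}.

Section MonoidAlgebra.
Variables (K : fieldType) (S : finMonoidType).
Local Notation A := (monoid_algebra K S).

HB.instance Definition _ := Vector.copy A {ffun S -> K^o}.

Definition monoid_algebra_basis (x : S) : A := [ffun s => (s == x)%:R].

Definition monoid_algebra_one : A := monoid_algebra_basis 1%g.

Definition monoid_algebra_mul (f g : A) : A :=
  [ffun s => \sum_(p : S * S | (p.1 * p.2)%g == s) f p.1 * g p.2].

Local Notation e := monoid_algebra_basis.
Local Notation mul := monoid_algebra_mul.

Lemma monoid_algebra_sumE (f : A) : f = \sum_x f x *: e x.
Proof.
apply/ffunP => s; rewrite sum_ffunE (bigD1 s) //= big1 ?addr0 => [|x nxs].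
  by rewrite !ffunE eqxx [RHS]mulr1.
by rewrite !ffunE eq_sym (negPf nxs) [LHS]mulr0.
Qed.

Lemma monoid_algebra_mulE (f g : A) :
  mul f g = \sum_x \sum_y (f x * g y) *: e (x * y)%g.
Proof.
rewrite pair_bigA /=; apply/ffunP => s; rewrite sum_ffunE ffunE big_mkcond /=.
apply: eq_bigr => p _; rewrite !ffunE eq_sym.
by case: eqP => _; rewrite ?[RHS]mulr1 ?[RHS]mulr0.
Qed.

Fact monoid_algebra_mulDl : left_distributive mul +%R.
Proof.
move=> f g h; apply/ffunP => s; rewrite !ffunE -big_split /=.
by apply: eq_bigr => p _; rewrite ffunE mulrDl.
Qed.

Fact monoid_algebra_mulDr : right_distributive mul +%R.
Proof.
move=> f g h; apply/ffunP => s; rewrite !ffunE -big_split /=.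
by apply: eq_bigr => p _; rewrite ffunE mulrDr.
Qed.

Fact monoid_algebra_scaleAl (k : K) (f g : A) : k *: mul f g = mul (k *: f) g.
Proof.
apply/ffunP => s; rewrite !ffunE scaler_sumr; apply: eq_bigr => p _.
by rewrite ffunE; apply: mulrA.
Qed.

Fact monoid_algebra_scaleAr (k : K) (f g : A) : k *: mul f g = mul f (k *: g).
Proof.
apply/ffunP => s; rewrite !ffunE scaler_sumr; apply: eq_bigr => p _.
by rewrite ffunE; apply: mulrCA.
Qed.

Lemma monoid_algebra_mul_basis (x y : S) : mul (e x) (e y) = e (x * y)%g.
Proof.
apply/ffunP => s; rewrite !ffunE big_mkcond (bigD1 (x, y)) //= big1 ?addr0.
  by rewrite !ffunE !eqxx mulr1 eq_sym; case: eqP.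
move=> [z t]; rewrite -pair_eqE /= !ffunE => /nandP[] /negPf->.
  by rewrite mul0r if_same.
by rewrite mulr0 if_same.
Qed.

Fact monoid_algebra_mul_suml (I : finType) (F : I -> A) g :
  mul (\sum_i F i) g = \sum_i mul (F i) g.
Proof.
apply: (big_morph (mul^~ g)) => [f1 f2|]; first exact: monoid_algebra_mulDl.
by rewrite -(scale0r (0 : A)) -monoid_algebra_scaleAl !scale0r.
Qed.

Fact monoid_algebra_mul_sumr (I : finType) (F : I -> A) f :
  mul f (\sum_i F i) = \sum_i mul f (F i).
Proof.
apply: (big_morph (mul f)) => [g1 g2|]; first exact: monoid_algebra_mulDr.
by rewrite -(scale0r (0 : A)) -monoid_algebra_scaleAr !scale0r.
Qed.

Fact monoid_algebra_mulA : associative mul.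
Proof.
move=> f g h.
rewrite (monoid_algebra_sumE f) !monoid_algebra_mul_suml; apply: eq_bigr => x _.
rewrite (monoid_algebra_sumE g).
rewrite !(monoid_algebra_mul_suml, monoid_algebra_mul_sumr).
apply: eq_bigr => y _; rewrite (monoid_algebra_sumE h).
rewrite !monoid_algebra_mul_sumr; apply: eq_bigr => z _.
rewrite -!(monoid_algebra_scaleAl, monoid_algebra_scaleAr).
rewrite !monoid_algebra_mul_basis mulgA !scalerA.
by rewrite -[h z * _ * _]mulrA [h z * _]mulrC.
Qed.

Fact monoid_algebra_mul1l : left_id monoid_algebra_one mul.
Proof.
move=> f; rewrite {1}(monoid_algebra_sumE f) monoid_algebra_mul_sumr.
rewrite [RHS]monoid_algebra_sumE; apply: eq_bigr => x _.
by rewrite -monoid_algebra_scaleAr monoid_algebra_mul_basis mul1g.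
Qed.

Fact monoid_algebra_mul1r : right_id monoid_algebra_one mul.
Proof.
move=> f; rewrite {1}(monoid_algebra_sumE f) monoid_algebra_mul_suml.
rewrite [RHS]monoid_algebra_sumE; apply: eq_bigr => x _.
by rewrite -monoid_algebra_scaleAl monoid_algebra_mul_basis mulg1.
Qed.

Fact monoid_algebra_oner_neq0 : monoid_algebra_one != 0.
Proof.
by apply/eqP => /ffunP/(_ 1%g)/eqP; rewrite !ffunE eqxx oner_eq0.
Qed.

HB.instance Definition _ := GRing.Zmodule_isNzRing.Build A
  monoid_algebra_mulA monoid_algebra_mul1l monoid_algebra_mul1r
  monoid_algebra_mulDl monoid_algebra_mulDr monoid_algebra_oner_neq0.
HB.instance Definition _ :=
  GRing.Lmodule_isLalgebra.Build K A monoid_algebra_scaleAl.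
HB.instance Definition _ :=
  GRing.Lalgebra_isAlgebra.Build K A monoid_algebra_scaleAr.
HB.instance Definition _ := Algebra_isFalgebra.Build K A.

End MonoidAlgebra.

(* [{ffun 'I_n -> K^o}], with its pointwise operations, is the product of [n]
   copies of [K]. *)
Definition split_semisimple (K : fieldType) (A : falgType K) : Prop :=
  exists (n : nat) (f : {lrmorphism A -> {ffun 'I_n -> K^o}}), bijective f.

Section Diagonalizable.
Variables (K : fieldType) (A : falgType K) (V : lmodType A).

(* The [K]-vector space structure of the [A]-module [V] is the one induced by
   the scalars [c%:A] of [A]. *)
Definition action_eigenspace (a : A) (c : K) (v : V) : Prop :=
  a *: v = c%:A *: v.

(* [V] may be infinite-dimensional, and the sum is over all scalars [c]:
   vectors decompose uniquely as finitely supported families. *)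
Definition is_direct_sum (I : choiceType) (W : I -> V -> Prop) : Prop :=
  forall v : V, exists! u : {fsfun I -> V with 0},
    (forall i, W i (u i)) /\ v = \sum_(i <- finsupp u) u i.

Definition diagonalizable_action (a : A) : Prop :=
  is_direct_sum (action_eigenspace a).

End Diagonalizable.

(* Main.v *)
Require Import Defs.
From HB Require Import structures.
From mathcomp Require Import all_boot all_order all_algebra all_field.
From mathcomp Require Import reals.
From mathcomp Require Import finmap.

Set Implicit Arguments.
Unset Strict Implicit.
Unset Printing Implicit Defensive.

Import Order.TTheory GRing.Theory Num.Theory.
Local Open Scope ring_scope.

(** In the semigroup algebra write [e x] for the basis element of [x], and let
[lam x] be the sum of the weights [w y] over the [y] with [x y = x], that is,
with [supp y <= supp x]. Multiplying [e x] by [w] on the right gives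

  [e x * (w - lam x) = \sum_(y | x y != x) w y * e (x y)].

Every term on the right that has a nonzero coefficient satisfies
[lam x < lam (x y)]: whatever fixes [x] on the right also fixes [x y], and [y]
itself fixes [x y] but not [x]; since no weight is negative and [w y] is positive,
the sum strictly increases ([walk_eigenvalue_lt]). By induction from the largest
values of [lam] downwards, [e x] is killed by the product of the [w - c] over the
distinct values [c >= lam x] of [lam]: after the factor [w - lam x], only basis
elements with larger values are left, and the factors that kill them are still
available. For [x = 1] this says that [w] is annihilated by a product of distinct
linear factors ([walk_annihilator]).

The rest is linear algebra in any finite-dimensional algebra. If [a] is
annihilated by [\prod_(c <- s) ('X - c)] with [s] duplicate free, then [q(a)]
depends only on the values of [q] on [s]. The Lagrange polynomials of [s]
evaluated at [a] are therefore orthogonal idempotents of sum [1], and [a] acts on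
the one attached to [c] as the scalar [c]. Those that are nonzero form a basis of
the subalgebra generated by [a], which makes it a product of copies of the field;
and on a module they are the projections onto the eigenspaces of [a]. *)

(** * Right multiplication by a nonnegative element of a left-regular band *)

Section Eigenvalues.
Variables (R : realFieldType) (S : finMonoidType).
Hypothesis hS : left_regular_band S.
Implicit Types x y z : S.

Lemma left_regular_band_mulKr x y : (x * y * x = x * y)%g.
Proof.
by have [d [L [supp [_ suppM suppP]]]] := hS; rewrite suppP // suppM leUl.
Qed.

Lemma left_regular_band_idem x : (x * x = x)%g.
Proof. by rewrite -{1}[x]mulg1 left_regular_band_mulKr mulg1. Qed.

(** Elements acting trivially on the right of [x] still do so after [x] is
multiplied by [y], their support being below that of [x]. *)
Lemma left_regular_band_absorb x y z : (x * z = x -> x * y * z = x * y)%g.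
Proof.
move=> xzK; rewrite -{1 2}xzK -!mulgA; congr (x * _)%g.
by rewrite mulgA left_regular_band_mulKr.
Qed.

Variable w : monoid_algebra R S.
Hypothesis w_ge0 : forall x, 0 <= w x.

(** The condition [x * y = x] expresses [supp y <= supp x], so this is the total
weight of the elements whose support is below that of [x]. *)
Definition walk_eigenvalue x : R := \sum_(y | (x * y == x)%g) w y.

Local Notation lam := walk_eigenvalue.
Local Notation e := (@monoid_algebra_basis R S).

(** The right-hand sum contains all terms of the left-hand one, and also [w y],
because [x * y * y = x * y]. It is here that nonnegativity of the weights is
essential: it is what makes the eigenvalues along a chain pairwise distinct. *)
Lemma walk_eigenvalue_lt x y :
  (x * y)%g != x -> w y != 0 -> lam x < lam (x * y)%g.
Proof.
move=> xyNx wyN0; rewrite /lam [ltRHS](bigID (fun z => x * z == x)%g) /=.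
rewrite [X in _ < X + _](eq_bigl (fun z => x * z == x)%g) => [|z]; last first.
  by apply/andb_idl => /eqP/(left_regular_band_absorb y)->.
rewrite ltrDl (bigD1 y) /=; last by rewrite -mulgA left_regular_band_idem eqxx.
by rewrite ltr_wpDr ?sumr_ge0 // lt0r wyN0 w_ge0.
Qed.

Lemma basis_mul_walk x :
  e x * (w - (lam x)%:A) = \sum_(y | (x * y != x)%g) w y *: e (x * y)%g.
Proof.
rewrite mulrBr [w in LHS]monoid_algebra_sumE mulr_sumr.
rewrite (bigID (fun y => x * y == x)%g) /= -scalerAr mulr1 scaler_suml addrAC.
rewrite [X in X + _](_ : _ = 0) ?add0r.
  by apply: eq_bigr => y _; rewrite -scalerAr [_ * _]monoid_algebra_mul_basis.
apply/eqP; rewrite subr_eq0; apply/eqP/eq_bigr => y /eqP xyx.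
by rewrite -scalerAr [_ * _]monoid_algebra_mul_basis xyx.
Qed.

(** Incomparable supports may have the same weight; keeping one copy of each value
is what makes the annihilating polynomial separable. *)
Definition walk_spectrum : seq R := undup (codom lam).

(** The predicate [P] is kept general so that the induction can remove the root
[lam x] from the product: the elements [x * y] that remain have strictly larger
values, so [P] without [lam x] still contains the roots they need. The induction
is on the number of elements with a value larger than [lam x]. *)
Lemma basis_mul_walk_annihilator (P : pred R) x :
    (forall c, lam x <= c -> P c) ->
  e x * horner_alg w (\prod_(c <- walk_spectrum | P c) ('X - c%:P)) = 0.
Proof.
have [n le_n] := ubnP #|[set y | lam x < lam y]|.
elim: n x P le_n => // n IHn x P le_n geP.
rewrite -big_filter (bigD1_seq (lam x)) ?filter_uniq ?undup_uniq //=;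
    last first.
  by rewrite mem_filter geP ?lexx // mem_undup codom_f.
rewrite big_filter_cond rmorphM mulrA rmorphB /= horner_algX horner_algC.
rewrite basis_mul_walk.
rewrite mulr_suml big1 // => y xyNx; rewrite -scalerAl.
have [->|wyN0] := eqVneq (w y) 0; first by rewrite scale0r.
have lt_xy := walk_eigenvalue_lt xyNx wyN0.
rewrite IHn ?scaler0 // => [|c le_c]; last first.
  by have lt_c := lt_le_trans lt_xy le_c; rewrite geP ?ltW // gt_eqF.
rewrite -ltnS (leq_trans _ le_n) // ltnS proper_card //.
apply/properP; split; first by apply/subsetP => z; rewrite !inE; apply: lt_trans.
by exists (x * y)%g; rewrite inE ?ltxx.
Qed.

(** The case of the identity element, whose basis vector is [1]. *)
Theorem walk_annihilator :
  horner_alg w (\prod_(c <- walk_spectrum) ('X - c%:P)) = 0.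
Proof. by rewrite -[LHS]mul1r (@basis_mul_walk_annihilator xpredT). Qed.

End Eigenvalues.

(** * Algebras spanned by orthogonal idempotents *)

Section SplitSemisimple.
Variables (K : fieldType) (A : falgType K) (n : nat) (E : 'I_n -> A).
Hypotheses (E_neq0 : forall i, E i != 0).
Hypothesis E_orth : forall i j, E i * E j = (i == j)%:R *: E i.
Hypothesis E_sum1 : \sum_i E i = 1.
Hypothesis E_span : forall a, exists u : 'I_n -> K, a = \sum_i u i *: E i.

Definition idempotent_comb (u : {ffun 'I_n -> K^o}) : A := \sum_i u i *: E i.

Lemma idempotent_comb_linear : linear idempotent_comb.
Proof.
move=> k u v; rewrite scaler_sumr -big_split; apply: eq_bigr => i _.
by rewrite !ffunE scalerDl scalerA.
Qed.

(** Multiplying by an idempotent reads off a coordinate; both injectivity and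
multiplicativity of [idempotent_comb] follow from this. *)
Lemma idempotent_combMr u i : idempotent_comb u * E i = u i *: E i.
Proof.
rewrite mulr_suml (bigD1 i) //= -scalerAl E_orth eqxx scale1r big1 ?addr0 //.
by move=> j /negPf ji; rewrite -scalerAl E_orth ji scale0r scaler0.
Qed.

Lemma idempotent_comb_monoid : monoid_morphism idempotent_comb.
Proof.
split=> [|u v].
  by rewrite -E_sum1; apply: eq_bigr => i _; rewrite ffunE scale1r.
rewrite {3}/idempotent_comb mulr_sumr; apply: eq_bigr => i _.
by rewrite -scalerAr idempotent_combMr scalerA ffunE mulrC.
Qed.

(** The coordinates in the basis of idempotents have no formula of their own; the
isomorphism is obtained as the inverse of [idempotent_comb], and it inherits the
morphism laws from it. *)
Lemma split_semisimple_idempotents : split_semisimple A.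
Proof.
have comb_inj : injective idempotent_comb.
  move=> u v uv; apply/ffunP => i; apply/eqP; rewrite -subr_eq0.
  have /eqP := congr1 ( *%R^~ (E i)) uv.
  rewrite -subr_eq0 !idempotent_combMr -scalerBl scaler_eq0.
  by rewrite (negPf (E_neq0 i)) orbF.
have comb_surj a : exists u, idempotent_comb u == a.
  have [u ->] := E_span a; exists [ffun i => u i]; apply/eqP.
  by apply: eq_bigr => i _; rewrite ffunE.
pose coord a := xchoose (comb_surj a).
have coordK : cancel coord idempotent_comb.
  by move=> a; apply/eqP/(xchooseP (comb_surj a)).
have combK := inj_can_sym coordK comb_inj.
pose combL := GRing.isLinear.Build K _ A _ _ idempotent_comb_linear.
pose combM := GRing.isMonoidMorphism.Build _ A _ idempotent_comb_monoid.
pose combl : {linear {ffun 'I_n -> K^o} -> A} := HB.pack idempotent_comb combL.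
pose combm : {rmorphism {ffun 'I_n -> K^o} -> A} :=
  HB.pack idempotent_comb combL combM.
pose coordL := GRing.isLinear.Build K A _ _ coord
  (can2_linear (f := combl) combK coordK).
pose coordM := GRing.isMonoidMorphism.Build A _ coord
  (can2_monoid_morphism (f := combm) combK coordK).
pose f : {lrmorphism A -> {ffun 'I_n -> K^o}} := HB.pack coord coordL coordM.
by exists n, f; exists idempotent_comb.
Qed.

End SplitSemisimple.

(** * Elements annihilated by a product of distinct linear factors *)

Lemma horner_algZ (K : fieldType) (A : falgType K) (a : A) k (q : {poly K}) :
  horner_alg a (k *: q) = k *: horner_alg a q.
Proof. by rewrite -mul_polyC rmorphM /= horner_algC mulr_algl. Qed.

Section SplitAnnihilator.
Variables (K : fieldType) (A : falgType K) (a : A) (s : seq K).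
Hypothesis s_uniq : uniq s.
Hypothesis a_annihilated : horner_alg a (\prod_(c <- s) ('X - c%:P)) = 0.

(** All identities between polynomials in [a] are reduced by this lemma to an
evaluation at the points of [s]: a polynomial vanishing there is a multiple of
the annihilating one, the points being distinct. *)
Lemma horner_alg_eq0_on_roots (q : {poly K}) :
  (forall c, c \in s -> q.[c] = 0) -> horner_alg a q = 0.
Proof.
move=> q0; have /Pdiv.Field.dvdpP[p ->] : \prod_(c <- s) ('X - c%:P) %| q.
  apply: uniq_roots_dvdp; first by apply/allP => c sc; apply/rootP/q0.
  by rewrite uniq_rootsE.
by rewrite rmorphM /= a_annihilated mulr0.
Qed.

(** The Lagrange interpolation polynomial of the node [c]. For [c] outside [s] it
is a multiple of the annihilating polynomial that takes the value [1] at [c];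
this makes the statements below uniform in [c]. *)
Definition spectral_poly c : {poly K} :=
  \prod_(d <- s | d != c) ((c - d)^-1 *: ('X - d%:P)).

Lemma horner_spectral_poly_id c : (spectral_poly c).[c] = 1.
Proof.
rewrite horner_prod big1 // => d dc.
by rewrite !hornerE mulVf // subr_eq0 eq_sym.
Qed.

Lemma horner_spectral_poly c d : c \in s -> (spectral_poly d).[c] = (c == d)%:R.
Proof.
move=> sc; case: eqVneq => [->|ncd]; first exact: horner_spectral_poly_id.
rewrite horner_prod; apply/eqP; rewrite prodf_seq_eq0; apply/hasP.
exists c => //.
by rewrite ncd !hornerE subrr mulr0 eqxx.
Qed.

Definition spectral_idempotent c : A := horner_alg a (spectral_poly c).
Local Notation E := spectral_idempotent.

(** Lagrange interpolation, read in the algebra. *)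
Lemma horner_alg_spectral q : horner_alg a q = \sum_(c <- s) q.[c] *: E c.
Proof.
apply/eqP; rewrite -subr_eq0.
under eq_bigr do rewrite -horner_algZ; rewrite -raddf_sum -raddfB; apply/eqP.
apply: horner_alg_eq0_on_roots => c sc; rewrite hornerD hornerN horner_sum.
rewrite (bigD1_seq c) //= big1 ?addr0 => [|d /negPf dc].
  by rewrite hornerZ horner_spectral_poly // eqxx mulr1 subrr.
by rewrite hornerZ horner_spectral_poly // eq_sym dc mulr0.
Qed.

Lemma spectral_idempotent_eq0 c : c \notin s -> E c = 0.
Proof.
move=> sNc; apply: horner_alg_eq0_on_roots => d sd.
by rewrite horner_spectral_poly //; case: eqP sd sNc => // -> ->.
Qed.

Lemma spectral_idempotent_orth c d : E c * E d = (c == d)%:R *: E c.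
Proof.
apply/eqP; rewrite -subr_eq0 -horner_algZ -rmorphM -raddfB; apply/eqP.
apply: horner_alg_eq0_on_roots => r sr.
rewrite hornerD hornerN hornerM hornerZ !horner_spectral_poly //.
case: (eqVneq r c) => [->|_]; last by rewrite mul0r mulr0 subrr.
by rewrite mul1r mulr1 subrr.
Qed.

Lemma mul_spectral_idempotent c : E c * a = c *: E c.
Proof.
apply/eqP; rewrite -subr_eq0 -{1}(horner_algX a) -horner_algZ -rmorphM -raddfB.
apply/eqP/horner_alg_eq0_on_roots => r sr.
rewrite hornerD hornerN hornerM hornerZ hornerX horner_spectral_poly //.
by case: eqVneq => [->|_]; rewrite ?mulr0 ?mul0r ?subrr // mul1r mulr1 subrr.
Qed.

Lemma mem_horner_alg q : horner_alg a q \in <<1; a>>%VS.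
Proof.
have A1 : 1 \in <<1; a>>%VS by rewrite memvE sub1_agenv.
elim/poly_ind: q => [|q c IHq]; first by rewrite raddf0 mem0v.
rewrite rmorphD rmorphM /= horner_algX horner_algC memvD ?memvZ //.
by rewrite (@memvM _ _ <<1; a>>%AS) ?memv_adjoin.
Qed.

(** The nonzero spectral idempotents span the subalgebra generated by [a]: their
span contains [1] and is stable under multiplication by [a], and each of them is
a polynomial in [a]. *)
Theorem split_semisimple_adjoin : split_semisimple (subvs_of <<1; a>>%AS).
Proof.
set B := <<1; a>>%AS.
(* A root of the annihilating polynomial need not be an eigenvalue of [a]; the
   roots that are not have a zero idempotent and are discarded. *)
pose s' := [seq c <- s | E c != 0].
have sum_s' q : horner_alg a q = \sum_(i < size s') q.[s'`_i] *: E s'`_i.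
  rewrite horner_alg_spectral -(big_mkord xpredT (fun i => _ s'`_i *: E s'`_i)).
  rewrite -(big_nth 0 xpredT (fun c => q.[c] *: E c)) big_filter [RHS]big_mkcond.
  by apply: eq_bigr => c _; case: eqP => //= ->; rewrite scaler0.
have sum1 : 1 = \sum_(i < size s') E s'`_i.
  have := sum_s' 1; rewrite rmorph1 => ->.
  by apply: eq_bigr => i _; rewrite hornerC scale1r.
pose X := [tuple E s'`_i | i < size s'].
have tnthX (i : 'I_(size s')) : X`_i = E s'`_i.
  by rewrite -tnth_nth tnth_mktuple.
have sub_BX : (B <= <<X>>)%VS.
  have memX (i : 'I_(size s')) : E s'`_i \in <<X>>%VS.
    by rewrite -tnthX memv_span // mem_nth ?size_tuple.
  apply: agenv_sub_modr; first by rewrite -memvE sum1 rpred_sum.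
  apply/prodvP => u v uX /memv_addP[_ /vlineP[k ->]] [_ /vlineP[l ->]] ->.
  rewrite mulrDr -!scalerAr mulr1 memvD ?memvZ //.
  rewrite (coord_span uX) mulr_suml rpred_sum // => i _.
  by rewrite tnthX -scalerAl mul_spectral_idempotent !memvZ.
have E_B c : E c \in B by apply: mem_horner_alg.
pose F (i : 'I_(size s')) := vsproj B (E s'`_i).
have valF i : vsval (F i) = E s'`_i by rewrite vsprojK.
have sB1 : vsval (1 : subvs_of B) = 1.
  by apply/eqP; rewrite algid_eq1 -(rmorph1 (horner_alg a)) mem_horner_alg.
apply: (@split_semisimple_idempotents K _ _ F).
- move=> i; apply: contraTneq (mem_nth 0 (ltn_ord i)) => Fi0.
  by rewrite mem_filter -valF Fi0 eqxx.
- move=> i j; apply: val_inj; rewrite linearZ /= !valF spectral_idempotent_orth.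
  by rewrite nth_uniq ?filter_uniq.
- apply: val_inj; rewrite [RHS]sB1 sum1 linear_sum /=.
  by apply: eq_bigr => i _; rewrite valF.
move=> b; exists (fun i => coord X i (vsval b)); apply: val_inj.
rewrite linear_sum [LHS](coord_span (subvP sub_BX _ (subvsP b))).
by apply: eq_bigr => i _; rewrite linearZ /= valF tnthX.
Qed.

Section Module.
Variable V : lmodType A.
Implicit Types (v : V) (c d : K).

Lemma horner_alg_eigenspace q c v :
  action_eigenspace a c v -> (horner_alg a q : A) *: v = q.[c]%:A *: v.
Proof.
move=> av; elim/poly_ind: q => [|q d IHq].
  by rewrite raddf0 horner0 !scale0r.
rewrite rmorphD rmorphM /= horner_algX horner_algC hornerMXaddC.
rewrite !scalerDl; congr (_ + _); rewrite -[LHS]scalerA av [LHS]scalerA.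
have -> : horner_alg a q * c%:A = c%:A * horner_alg a q.
  by rewrite mulr_algr mulr_algl.
by rewrite -[LHS]scalerA IHq scalerA mulr_algl scalerA mulrC.
Qed.

Lemma spectral_idempotent_eigenspace c v :
  action_eigenspace a c (E c *: v).
Proof.
have comm : a * E c = E c * a.
  by rewrite -(horner_algX a) -!rmorphM mulrC.
by rewrite /action_eigenspace !scalerA comm mul_spectral_idempotent mulr_algl.
Qed.

(** An eigenvector for a scalar [d] outside [s] is zero: the polynomial
[spectral_poly d] acts on it both as its value [1] at [d] and, since it vanishes
on [s], as [0]. *)
Lemma spectral_idempotent_act c d v :
  action_eigenspace a d v -> E c *: v = if d == c then v else 0.
Proof.
move=> av.
have [sd|sNd] := boolP (d \in s); last first.
  suff -> : v = 0 by rewrite scaler0 if_same.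
  have := horner_alg_eigenspace (spectral_poly d) av.
  rewrite -/(E d) spectral_idempotent_eq0 // horner_spectral_poly_id scale1r.
  by rewrite scale0r scale1r.
rewrite (horner_alg_eigenspace _ av) horner_spectral_poly //.
by case: eqP => _; rewrite ?scale0r ?scale1r.
Qed.

(** The component of [v] at [c] has to be [E c *: v]: applying [E c] to any
decomposition of [v] into eigenvectors isolates its component at [c]. *)
Theorem diagonalizable_annihilated : diagonalizable_action V a.
Proof.
move=> v.
pose u : {fsfun K -> V with 0} :=
  [fsfun c in [fset c in s]%fset => E c *: v | 0].
have uE c : u c = E c *: v.
  rewrite fsfunE !inE; case: ifPn => // sNc.
  by rewrite spectral_idempotent_eq0 ?scale0r.
have u_sum : \sum_(c <- s) u c = \sum_(c <- finsupp u) u c.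
  apply: perm_big_supp; rewrite uniq_perm ?filter_uniq ?fset_uniq // => c.
  rewrite !mem_filter mem_finsupp; case: eqVneq => //=; rewrite uE.
  by apply: contraNT => /spectral_idempotent_eq0->; rewrite scale0r.
exists u; split.
  split=> [c|]; first by rewrite uE; apply: spectral_idempotent_eigenspace.
  have := horner_alg_spectral 1; rewrite rmorph1 -{1}[v]scale1r => ->.
  rewrite scaler_suml -u_sum.
  by apply: eq_bigr => c _; rewrite hornerC scale1r uE.
move=> u' [u'_eigen v_sum]; apply/fsfunP => c; rewrite uE v_sum scaler_sumr.
under eq_bigr do rewrite (spectral_idempotent_act _ (u'_eigen _)).
rewrite -big_mkcond /=.
have [cu|cNu] := boolP (c \in finsupp u').
  by rewrite -big_filter filter_pred1_uniq ?fset_uniq // big_seq1.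
rewrite fsfun_dflt // big1_seq // => d /andP[/eqP-> cu].
by rewrite cu in cNu.
Qed.

End Module.
End SplitAnnihilator.

(** * Probability distributions on a left-regular band *)

Theorem theorem5 (R : realType) (S : finMonoidType) (hS : left_regular_band S)
    (w : monoid_algebra R S)
    (w_ge0 : forall x : S, 0 <= w x) (w_sum1 : \sum_(x : S) w x = 1) :
  split_semisimple (subvs_of <<1; w>>%AS) /\
  (forall V : lmodType (monoid_algebra R S), diagonalizable_action V w).
Proof.
have w_annihilated := walk_annihilator hS w_ge0.
have s_uniq : uniq (walk_spectrum w) by apply: undup_uniq.
split; first exact: split_semisimple_adjoin s_uniq w_annihilated.
by move=> V; apply: diagonalizable_annihilated s_uniq w_annihilated _.
Qed.
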